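(* Let $\{c_{\ell m}\}_{\ell\ge0,\,-\ell\le m\le\ell}$ be any real numbers with $\sum_{\ell=0}^\infty\sum_{m=-\ell}^{\ell}c_{\ell m}^2<\infty$, and define $$\Theta(p)=\Big(\sum_{\ell=0}^\infty\sum_{m=-\ell}^{\ell}c_{\ell m}Y_{\ell m}\big(\tfrac{p}{|p|}\big)\Big)|p| .$$ Then: (i) $\Theta\in L^2\left(\mathbb{R}^3,\frac{dp}{\sinh^2k}\right)$; (ii) $-M(p)\Theta(p)+\int_{\mathbb{R}^3}\Theta(p')\,W(p,p')\,dp'=0$ (for a.e. $p\in\mathbb{R}^3$).
   Context: All functions are real valued. $c,k_B,T>0$ are fixed constants. For $p\in\mathbb{R}^3$ write $r=|p|$ and $k=k(p)=\frac{c|p|}{2k_BT}$. $n_0(r)=\frac{1}{e^{cr/(k_BT)}-1}$. $\{Y_{\ell m}\}$ is the orthonormal basis of $L^2(\mathbb{S}^2)$ of (real) spherical harmonics. Let $H$ be the Heaviside function and, for $r,r'>0$, $$W_0(r,r')=4\left(\tfrac{c}{2k_BT}\right)^5\Big[(r-r')^2H(r-r')\,n_0(r)(1+n_0(r'))(1+n_0(r-r'))+(r'-r)^2H(r'-r)\,n_0(r')(1+n_0(r))(1+n_0(r'-r))-(r+r')^2\,n_0(r+r')(1+n_0(r))(1+n_0(r'))\Big].$$ $W(p,p')$ is, for each $p\ne0$, a measure in $p'$ concentrated on the half-line spanned by $p$, acting on functions $g$ on $\mathbb{R}^3$ by $$\int_{\mathbb{R}^3}g(p')\,W(p,p')\,dp'=\int_0^\infty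 W_0(|p|,r')\,g\!\left(r'\tfrac{p}{|p|}\right)r'^2\,dr'.$$ The function $M$ is $M(p)=M(r)=\frac1r\int_0^\infty W_0(r,r')\,r'\,r'^2\,dr'$. *)

(* Defs.v *)
From HB Require Import structures.
From mathcomp Require Import all_boot all_order all_algebra.
From mathcomp Require Import all_classical all_reals all_analysis.
From mathcomp Require Import measurable_realfun.
(* The notations of [mpoly] clash with those of MathComp-Analysis. *)
From mathcomp Require Import (canonicals, coercions) mpoly.

Set Implicit Arguments.
Unset Strict Implicit.
Unset Printing Implicit Defensive.

Import Order.TTheory GRing.Theory Num.Theory.
Import numFieldNormedType.Exports.

Local Open Scope classical_set_scope.
Local Open Scope ring_scope.

(* [measurableTypeR R] is R with the Borel structure on which [lebesgue_measure]
   lives. *)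
Notation R3 R := (measurableTypeR R * measurableTypeR R * measurableTypeR R)%type.

Section euclidean_space.
Context {R : realType}.
Implicit Types p : R3 R.

Definition coord p (i : 'I_3) : R := nth 0 [:: p.1.1 : R; p.1.2 : R; p.2 : R] i.

(* The library norm on a product type is the sup norm. *)
Definition enorm p : R := Num.sqrt (\sum_(i < 3) coord p i ^+ 2).

Definition scale3 (a : R) p : R3 R := (a * p.1.1, a * p.1.2, a * p.2).

Definition direction p : R3 R := scale3 (enorm p)^-1 p.

Definition sphere : set (R3 R) := [set p | enorm p = 1].

Definition leb3 : {measure set (R3 R) -> \bar R} :=
  (@lebesgue_measure R \x @lebesgue_measure R \x @lebesgue_measure R)%E.

End euclidean_space.

Section measurability.
Context {R : realType}.

Lemma measurable_invr : measurable_fun [set: R] (fun x : R => x^-1).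
Proof.
have m0 : measurable [set (0 : R)] by exact: measurable_set1.
have -> : [set: R] = [set 0] `|` ~` [set 0] by rewrite setUv.
apply/measurable_funU => //; first exact: measurableC.
split; first exact: measurable_fun_set1.
apply: open_continuous_measurable_fun; first exact/closed_openC/closed_eq.
by move=> x; rewrite inE /= => /eqP x0; exact: inv_continuous.
Qed.

Lemma measurable_sqrtr : measurable_fun [set: R] (@Num.sqrt R).
Proof. by apply: continuous_measurable_fun; exact: sqrt_continuous. Qed.

Let mcoord i : measurable_fun [set: R3 R] (fun p => coord p i).
Proof.
case: i => [[|[|[|//]]]] ?; rewrite /coord /=.
- exact: measurableT_comp measurable_fst measurable_fst.
- exact: measurableT_comp measurable_snd measurable_fst.
- exact: measurable_snd.
Qed.

Lemma measurable_enorm : measurable_fun [set: R3 R] (@enorm R).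
Proof.
apply: (measurableT_comp measurable_sqrtr).
by apply: measurable_sum => i; exact: measurable_funX.
Qed.

Lemma measurable_direction : measurable_fun [set: R3 R] (@direction R).
Proof.
have mi : measurable_fun [set: R3 R] (fun p => (enorm p)^-1).
  exact: (measurableT_comp measurable_invr measurable_enorm).
have m i : measurable_fun [set: R3 R] (fun p => (enorm p)^-1 * coord p i).
  exact: measurable_funM.
apply: measurable_fun_pair; [apply: measurable_fun_pair|].
- exact: (m ord0).
- exact: (m (@Ordinal 3 1 isT)).
- exact: (m (@Ordinal 3 2 isT)).
Qed.

End measurability.

Definition punctured_ball {R : realType} : set (R3 R) :=
  [set p | 0 < enorm p <= 1].

Section surface_measure.
Context {R : realType}.

(* Surface measure of the unit sphere, as a Borel measure on the ambient space
   concentrated on [sphere]: sigma(A) is three times the volume of the cone over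
   A inside the unit ball, so the total mass is 4 pi.  Hence [Lfun surface 2%:E]
   is L^2(S^2). *)
Definition surface (A : set (R3 R)) : \bar R :=
  (3%:E * leb3 (punctured_ball `&` direction @^-1` A))%E.

Let measurable_punctured_ball : measurable (@punctured_ball R).
Proof.
rewrite (_ : punctured_ball = @enorm R @^-1` `]0, 1]%classic).
  by rewrite -[X in measurable X]setTI; apply: measurable_enorm.
by apply/seteqP; split => p /=; rewrite in_itv.
Qed.

Let surface0 : surface set0 = 0%E.
Proof. by rewrite /surface preimage_set0 setI0 measure0 mule0. Qed.

Let surface_ge0 A : (0 <= surface A)%E.
Proof. by rewrite /surface mule_ge0. Qed.

Let surface_sigma_additive : semi_sigma_additive surface.
Proof.
move=> F mF tF mUF; rewrite /surface preimage_bigcup setI_bigcupr.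
have mG i : measurable (punctured_ball `&` direction @^-1` F i).
  apply: measurableI; first exact: measurable_punctured_ball.
  by rewrite -[X in measurable X]setTI; exact: measurable_direction.
have tG : trivIset setT (fun i => punctured_ball `&` direction @^-1` F i).
  apply/trivIsetP => i j _ _ ij; rewrite setIACA setIid -preimage_setI.
  by move/trivIsetP : tF => /(_ i j Logic.I Logic.I ij) ->;
     rewrite preimage_set0 setI0.
have := @measure_semi_sigma_additive _ _ _ (@leb3 R) _ mG tG
  (bigcupT_measurable _ mG).
move=> /(cvgeZl (y := 3%:E) (isT : 3%:E \is a fin_num)).
apply: cvg_trans; apply: near_eq_cvg; near=> n => /=.
by rewrite ge0_sume_distrr.
Unshelve. all: by end_near. Qed.

HB.instance Definition _ := isMeasure.Build _ _ _
  surface surface0 surface_ge0 surface_sigma_additive.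

End surface_measure.

Section spherical_harmonics.
Context {R : realType}.
Implicit Types (f g : R3 R -> R) (Y : nat -> int -> R3 R -> R).
Implicit Types (a : nat -> int -> R).

(* Restriction to the unit sphere of a homogeneous harmonic polynomial. *)
Definition spherical_harmonic (l : nat) f : Prop :=
  exists P : mpoly.mpoly 3 R,
    [/\ P \is mpoly.ishomog1 l (@mpoly.mdeg 3),
        \sum_(i < 3) mpoly.mderiv i (mpoly.mderiv i P) = 0
      & forall p, sphere p -> f p = mpoly.meval (coord p) P].

Definition dotS2 f g : R := \int[surface]_p (f p * g p).

(* Only the values at -l <= m <= l matter. *)
Definition partial_sum Y a (L : nat) (p : R3 R) : R :=
  \sum_(l < L) \sum_(j < (2 * l).+1) a l (j%:Z - l%:Z) * Y l (j%:Z - l%:Z) p.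

(* f is (a representative of) the sum of the series of a_lm Y_lm in L^2(S^2). *)
Definition L2_sum Y a f : Prop :=
  f \in Lfun surface 2%:E /\
  ('N[surface]_2%:E[(fun p => (partial_sum Y a L p - f p)%:E)]
     @[L --> \oo] --> 0)%E.

(* Functions on the sphere are extended to the ambient space; the conditions
   [\in Lfun surface 2%:E] on the Y_lm only exclude non-measurable extensions. *)
Definition real_spherical_harmonic_basis Y : Prop :=
  [/\ forall l (m : int), `|m| <= l%:Z ->
        spherical_harmonic l (Y l m) /\ Y l m \in Lfun surface 2%:E,
      forall l l' (m m' : int), `|m| <= l%:Z -> `|m'| <= l'%:Z ->
        dotS2 (Y l m) (Y l' m') = ((l == l') && (m == m'))%:R
    & forall f, f \in Lfun surface 2%:E ->
        L2_sum Y (fun l m => dotS2 f (Y l m)) f].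

Definition square_summable a : Prop :=
  (\sum_(0 <= l <oo)
     (\sum_(j < (2 * l).+1) (a l (j%:Z - l%:Z)) ^+ 2)%:E < +oo)%E.

End spherical_harmonics.

Section kinetic.
Context {R : realType}.
Variables c kB T : R.
Implicit Types (r : R) (p : R3 R).

Definition sinh r : R := (expR r - expR (- r)) / 2.

(* In [W0] the value at 0 is multiplied by a vanishing factor. *)
Definition heaviside r : R := (0 < r)%R%:R.

Definition kappa p : R := c * enorm p / (2 * kB * T).

Definition n0 r : R := (expR (c * r / (kB * T)) - 1)^-1.

Definition W0 r r' : R :=
  4 * (c / (2 * kB * T)) ^+ 5 *
  ((r - r') ^+ 2 * heaviside (r - r') *
     (n0 r * (1 + n0 r') * (1 + n0 (r - r')))
   + (r' - r) ^+ 2 * heaviside (r' - r) *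
     (n0 r' * (1 + n0 r) * (1 + n0 (r' - r)))
   - (r + r') ^+ 2 * (n0 (r + r') * (1 + n0 r) * (1 + n0 r'))).

Local Open Scope ereal_scope.

(* The integrals are extended real valued, and a Lebesgue integral whose positive
   and negative parts are both infinite is -oo; such an integral is therefore
   finite exactly when it converges absolutely. *)

(* The action g |-> \int g(p') W(p, p') dp' of the measure W(p, .). *)
Definition Wint (g : R3 R -> R) p : \bar R :=
  \int[lebesgue_measure]_(r' in `]0%R, +oo[)
    (W0 (enorm p) r' * g (scale3 r' (direction p)) * r' ^+ 2)%:E.

Definition M r : \bar R :=
  (r^-1)%:E *
  \int[lebesgue_measure]_(r' in `]0%R, +oo[) (W0 r r' * r' * r' ^+ 2)%:E.

(* The measure dp / sinh^2 k. *)
Definition sinh_measure (A : set (R3 R)) : \bar R :=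
  \int[leb3]_(p in A) ((sinh (kappa p) ^+ 2)^-1)%:E.

Let weight_ge0 p : 0 <= ((sinh (kappa p) ^+ 2)^-1)%:E.
Proof. by rewrite lee_fin invr_ge0 sqr_ge0. Qed.

Let measurable_weight :
  measurable_fun [set: R3 R] (fun p => (sinh (kappa p) ^+ 2)^-1)%R.
Proof.
apply: (measurableT_comp measurable_invr); apply: measurable_funX.
have mk : measurable_fun [set: R3 R] kappa.
  apply: measurable_funM => //; apply: measurable_funM => //.
  exact: measurable_enorm.
apply: measurable_funM => //; apply: measurable_funB.
  exact: (measurableT_comp (@measurable_expR R) mk).
apply: (measurableT_comp (@measurable_expR R)).
exact: measurableT_comp mk.
Qed.

Let sinh_measure0 : sinh_measure set0 = 0.
Proof. by rewrite /sinh_measure integral_set0. Qed.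

Let sinh_measure_ge0 A : 0 <= sinh_measure A.
Proof. exact: integral_ge0. Qed.

Let sinh_measure_sigma_additive : semi_sigma_additive sinh_measure.
Proof.
move=> /= F mF tF mUF; rewrite /sinh_measure; apply: cvg_toP.
  apply: ereal_nondecreasing_is_cvgn => m n mn.
  by apply: lee_sum_nneg_natr => // k _ _; exact: integral_ge0.
rewrite ge0_integral_bigcup//=.
by apply/measurable_funTS/measurableT_comp.
Qed.

HB.instance Definition _ := isMeasure.Build _ _ _ sinh_measure
  sinh_measure0 sinh_measure_ge0 sinh_measure_sigma_additive.

End kinetic.

(* Main.v *)
Require Import Defs.
From mathcomp Require Import all_boot all_order all_algebra.
From mathcomp Require Import all_classical all_reals all_analysis.
From mathcomp Require Import measurable_realfun.
From mathcomp Require Import ring lra zify.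

Set Implicit Arguments.
Unset Strict Implicit.
Unset Printing Implicit Defensive.

Import Order.TTheory GRing.Theory Num.Theory.
Import numFieldNormedType.Exports.

Local Open Scope classical_set_scope.
Local Open Scope ring_scope.

(** The operator acts on each ray separately: the measure W(p, .) lives on the
    half-line spanned by p, where [Theta] is F(p/|p|) times the radius.  Hence
    the angular factor F(p/|p|) comes out of the gain integral, and what is left
    is the radial integral of W_0(|p|, r') r'^3, which is |p| M(|p|) by the
    definition of [M].  The two terms cancel as soon as this radial integral is
    finite; an infinite value would leave an undefined difference.  So the
    analytic content of (ii) is the absolute convergence of that moment of W_0
    ([integrable_W0_moment]).  Near r' = 0 and r' = r the poles of the occupation
    number n_0 are simple and are compensated by the factors r'^3 and
    (r - r')^2; at infinity n_0(r') or n_0(r + r') decays exponentially, so the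
    integrand is bounded by a multiple of an exponential density
    ([W0_moment_le]).

    The existence of F is the Riesz-Fischer theorem on the sphere.  By
    orthonormality the square of the distance between two partial sums is a
    block of the convergent series of the squared coefficients
    ([partial_sumB]), and L^2 of any measure is complete ([L2_complete]).

    For (i), Lebesgue measure on R^3 is homogeneous of degree 3
    ([leb3_dilation]), so the integral of F(p/|p|)^2 over the ball of radius 2^n
    is 8^n times its value on the unit ball, which the definition of the surface
    measure by cones identifies with a third of the squared norm of F
    ([integral_punctured_ball_lty]).  On the dyadic shell of outer radius 2^n
    the weight r^2 / sinh^2 k is O(16^-n) ([sqr_div_sinh_le]): it is bounded near
    the origin, because sinh k is at least linear, and it decays faster than
    any power at infinity.  The series of 16^-n 8^n converges. *)

(** * Exponential bounds on the collision kernel *)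

Ltac nonneg :=
  repeat first [ by [] | exact: sqr_ge0 | exact: expR_ge0 | exact: ltW
    | apply: mulr_ge0 | apply: addr_ge0 | apply: exprn_ge0 | rewrite invr_ge0 ].

(** Half of the decay rate is spent to absorb the polynomial factor. *)
Lemma exp_absorbs_powers {R : realType} (b : R) (k : nat) : 0 < b ->
  exists2 D : R, 0 <= D &
  forall s : R, 0 < s -> s ^+ k * expR (- (b * s)) <= D * expR (- (b / 2 * s)).
Proof.
move=> b0.
have [->|k0] := posnP k.
  exists 1 => // s s0; rewrite expr0 !mul1r ler_expR lerN2 ler_wpM2r ?(ltW s0)//.
  by rewrite ler_pdivrMr// ler_pMr// ler1n.
exists (k`!%:R * (b / 2)^-1 ^+ k).
  by rewrite mulr_ge0// exprn_ge0// invr_ge0 divr_ge0// ltW.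
move=> s s0; have h0 : 0 < b / 2 * s by rewrite mulr_gt0// divr_gt0.
have := @expR_ge1Dxn _ (b / 2 * s) k.-1 (ltW h0); rewrite prednK// => H.
have -> : expR (- (b * s)) = expR (- (b / 2 * s)) / expR (b / 2 * s).
  by rewrite -expRN -expRD; congr expR; field.
rewrite mulrCA mulrC ler_wpM2r ?expR_ge0// ler_pdivrMr ?expR_gt0//.
have F0 : 0 < (k`!%:R : R) by rewrite ltr0n fact_gt0.
apply: (@le_trans _ _ (k`!%:R * (b / 2)^-1 ^+ k *
    ((b / 2 * s) ^+ k / k`!%:R))).
  have : (b / 2) ^+ k != 0 by rewrite expf_neq0// gt_eqF// divr_gt0.
  rewrite le_eqVlt (exprMn _ (b / 2)) exprVn; move: ((b / 2) ^+ k) => v v0.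
  by apply/orP; left; apply/eqP; field; rewrite v0 gt_eqF.
rewrite ler_wpM2l//; last by lra.
by rewrite mulr_ge0 ?ltW// exprn_gt0// invr_gt0 divr_gt0.
Qed.

Section collision_kernel.
Context {R : realType}.
Variables c kB T : R.
Hypotheses (hc : 0 < c) (hkB : 0 < kB) (hT : 0 < T).

Local Notation b := (c / (2 * kB * T)).
Local Notation n := (n0 c kB T).

Lemma rate_gt0 : 0 < b.
Proof. by rewrite divr_gt0 ?mulr_gt0. Qed.

Lemma n0_denom x : c * x / (kB * T) = 2 * (b * x).
Proof. by field; rewrite !gt_eqF. Qed.

Lemma n0_ge0 x : 0 < x -> 0 <= n x.
Proof.
move=> x0; rewrite /n0 invr_ge0 subr_ge0 -expR0 ler_expR n0_denom.
by rewrite mulr_ge0// mulr_ge0 ?(ltW rate_gt0) ?ltW.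
Qed.

(** Writing e^(2y) - 1 = e^y (e^y - e^-y) keeps at once the simple pole at 0 and
    an exponential decay at infinity. *)
Lemma n0_le x : 0 < x -> n x <= expR (- (b * x)) / (b * x).
Proof.
move=> x0; have bx0 : 0 < b * x by rewrite mulr_gt0 ?rate_gt0.
rewrite /n0 n0_denom expRN -invfM lef_pV2 ?posrE.
- have e1 := expR_ge1Dx (b * x).
  have -> : expR (2 * (b * x)) = expR (b * x) * expR (b * x).
    by rewrite -expRD; congr expR; ring.
  nra.
- by rewrite subr_gt0 pexpR_gt1// mulr_gt0.
- by rewrite mulr_gt0 ?expR_gt0.
Qed.

Lemma n0_le_inv x : 0 < x -> x * n x <= b^-1.
Proof.
move=> x0; have b0 := rate_gt0; have bx0 : 0 < b * x by rewrite mulr_gt0.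
apply: (@le_trans _ _ (x * (1 / (b * x)))).
  rewrite ler_wpM2l ?(ltW x0)// (le_trans (n0_le x0))//.
  rewrite ler_wpM2r// ?invr_ge0 ?(ltW bx0)//.
  by rewrite expR_le1 oppr_le0 ltW.
by rewrite le_eqVlt; apply/orP; left; apply/eqP; field; rewrite !gt_eqF.
Qed.

(** The square, which comes from the momentum transfer in W_0, more than cancels
    the simple pole of n_0. *)
Lemma sqr_mul_1Dn0_le x : 0 < x -> x ^+ 2 * (1 + n x) <= x ^+ 2 + x * b^-1.
Proof.
move=> x0; rewrite mulrDr mulr1 lerD2l expr2 -mulrA ler_wpM2l ?(ltW x0)//.
exact: n0_le_inv.
Qed.

(** The term vanishes unless s < r, and there it is bounded; the product of the
    two exponentials on the right is at least 1 on this range. *)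
Lemma W0_gain_down_le r s : 0 < r -> 0 < s ->
  0 <= (r - s) ^+ 2 * heaviside (r - s) * (n r * (1 + n s) * (1 + n (r - s)))
         * s ^+ 3 <=
  (r ^+ 2 + r * b^-1) * n r * (r * (r ^+ 2 + r * b^-1))
    * expR (b / 2 * r) * expR (- (b / 2 * s)).
Proof.
move=> r0 s0; have b0 := rate_gt0; have bV0 : 0 < b^-1 by rewrite invr_gt0.
have nr := n0_ge0 r0; have ns := n0_ge0 s0.
have C0 : 0 <= (r ^+ 2 + r * b^-1) * n r * (r * (r ^+ 2 + r * b^-1)).
  by nonneg.
rewrite /heaviside subr_gt0; case: ltP => sr; last first.
  by rewrite mulr0 !mul0r lexx/=; nonneg.
have d0 : 0 < r - s by rewrite subr_gt0.
have nd := n0_ge0 d0; have qd := sqr_mul_1Dn0_le d0; have qs := sqr_mul_1Dn0_le s0.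
apply/andP; split.
  by nonneg.
apply: (@le_trans _ _
    ((r ^+ 2 + r * b^-1) * n r * (r * (r ^+ 2 + r * b^-1)))).
  have -> : (r - s) ^+ 2 * true%:R * (n r * (1 + n s) * (1 + n (r - s))) * s ^+ 3
     = ((r - s) ^+ 2 * (1 + n (r - s))) * n r * (s * (s ^+ 2 * (1 + n s))).
    by rewrite /=; ring.
  have mono u v : 0 < u -> u <= v -> u ^+ 2 + u * b^-1 <= v ^+ 2 + v * b^-1.
    move=> u0 uv; rewrite lerD// ?ler_wpM2r ?(ltW bV0)//.
    by rewrite ler_pXn2r// nnegrE ltW// (lt_le_trans u0).
  rewrite ler_pM//.
  - by nonneg.
  - by nonneg.
  - rewrite ler_wpM2r// (le_trans qd)// mono// lerBlDr lerDl ltW//.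
  - rewrite ler_pM// ?(ltW s0) ?(ltW sr)//.
      by nonneg.
    by rewrite (le_trans qs)// mono// ltW.
rewrite -[leRHS]mulrA ler_peMr// -expRD (le_trans _ (expR_ge1Dx _))//.
by rewrite lerDl subr_ge0 ler_wpM2l ?(ltW sr)//; nonneg.
Qed.

(** The term vanishes unless s > r; the decay comes from n_0(s). *)
Lemma W0_gain_up_le r s : 0 < r -> 0 < s ->
  0 <= (s - r) ^+ 2 * heaviside (s - r) * (n s * (1 + n r) * (1 + n (s - r)))
         * s ^+ 3 <=
  (1 + n r) * b^-1 * ((s ^+ 2 + s * b^-1) * s ^+ 2 * expR (- (b * s))).
Proof.
move=> r0 s0; have b0 := rate_gt0; have bV0 : 0 < b^-1 by rewrite invr_gt0.
have nr := n0_ge0 r0; have ns := n0_ge0 s0.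
rewrite /heaviside subr_gt0; case: ltP => sr; last first.
  by rewrite mulr0 !mul0r lexx/=; nonneg.
have d0 : 0 < s - r by rewrite subr_gt0.
have nd := n0_ge0 d0; have qd := sqr_mul_1Dn0_le d0.
apply/andP; split.
  by nonneg.
have -> : (s - r) ^+ 2 * true%:R * (n s * (1 + n r) * (1 + n (s - r))) * s ^+ 3
   = (1 + n r) * (((s - r) ^+ 2 * (1 + n (s - r))) * (s ^+ 2 * (n s * s))).
  by rewrite /=; ring.
have -> : (1 + n r) * b^-1 * ((s ^+ 2 + s * b^-1) * s ^+ 2 * expR (- (b * s)))
   = (1 + n r) * ((s ^+ 2 + s * b^-1) *
       (s ^+ 2 * (expR (- (b * s)) * b^-1))) by ring.
rewrite ler_wpM2l ?addr_ge0//; apply: ler_pM.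
- by nonneg.
- by nonneg.
- rewrite (le_trans qd)// lerD//.
    by rewrite ler_pXn2r ?nnegrE ?(ltW s0) ?(ltW d0)// lerBlDr lerDl ltW.
  by rewrite ler_wpM2r ?(ltW bV0)// lerBlDr lerDl ltW.
- rewrite ler_wpM2l ?sqr_ge0// -ler_pdivlMr// (le_trans (n0_le s0))//.
  by rewrite (invfM b) mulrA.
Qed.

(** The decay comes from n_0(r + s), and the factor s^3 compensates the pole of
    1 + n_0(s) at 0. *)
Lemma W0_loss_le r s : 0 < r -> 0 < s ->
  0 <= (r + s) ^+ 2 * (n (r + s) * (1 + n r) * (1 + n s)) * s ^+ 3 <=
  (1 + n r) * b^-1 * ((r + s) * (s ^+ 2 + s * b^-1) * s * expR (- (b * s))).
Proof.
move=> r0 s0; have b0 := rate_gt0; have bV0 : 0 < b^-1 by rewrite invr_gt0.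
have nr := n0_ge0 r0; have ns := n0_ge0 s0.
have d0 : 0 < r + s by rewrite addr_gt0.
have nd := n0_ge0 d0; have qs := sqr_mul_1Dn0_le s0.
apply/andP; split.
  by nonneg.
have -> : (r + s) ^+ 2 * (n (r + s) * (1 + n r) * (1 + n s)) * s ^+ 3
   = (1 + n r) * ((r + s) * (n (r + s) * (r + s)) * (s ^+ 2 * (1 + n s) * s)).
  by ring.
have -> : (1 + n r) * b^-1 * ((r + s) * (s ^+ 2 + s * b^-1) * s * expR (- (b * s)))
   = (1 + n r) * ((r + s) * (expR (- (b * s)) * b^-1) *
       ((s ^+ 2 + s * b^-1) * s)) by ring.
rewrite ler_wpM2l ?addr_ge0// ler_pM//.
- by nonneg.
- by nonneg.
- rewrite ler_wpM2l ?(ltW d0)// -ler_pdivlMr// (le_trans (n0_le d0))//.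
  rewrite (invfM b) mulrA ler_wpM2r ?invr_ge0 ?(ltW d0)// ler_wpM2r ?(ltW bV0)//.
  by rewrite ler_expR lerN2 ler_wpM2l ?(ltW b0)// lerDr ltW.
- by rewrite ler_wpM2r ?(ltW s0).
Qed.

(** Each of the three terms of W_0 is dominated separately; the polynomial
    factors of the bounds cost half of the decay rate. *)
Lemma W0_moment_le r : 0 < r -> exists C : R, forall s, 0 < s ->
  `|W0 c kB T r s * s * s ^+ 2| <= C * expR (- (b / 2 * s)).
Proof.
move=> r0; have b0 := rate_gt0; have bV0 : 0 < b^-1 by rewrite invr_gt0.
have [D2 _ H2] := exp_absorbs_powers 2 b0.
have [D3 _ H3] := exp_absorbs_powers 3 b0.
have [D4 _ H4] := exp_absorbs_powers 4 b0.
have nr := n0_ge0 r0.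
pose C1 := (r ^+ 2 + r * b^-1) * n r * (r * (r ^+ 2 + r * b^-1)) * expR (b / 2 * r).
exists (4 * b ^+ 5 * (C1 + (1 + n r) * b^-1 *
  (2 * D4 + (2 * b^-1 + r) * D3 + r * b^-1 * D2))) => s s0.
have /andP[t1 u1] := W0_gain_down_le r0 s0.
have /andP[t2 u2] := W0_gain_up_le r0 s0.
have /andP[t3 u3] := W0_loss_le r0 s0.
move: (H2 s s0) (H3 s s0) (H4 s s0) => {}H2 {}H3 {}H4.
have -> : W0 c kB T r s * s * s ^+ 2 = 4 * b ^+ 5 *
  ((r - s) ^+ 2 * heaviside (r - s) * (n r * (1 + n s) * (1 + n (r - s))) * s ^+ 3 +
  (s - r) ^+ 2 * heaviside (s - r) * (n s * (1 + n r) * (1 + n (s - r))) * s ^+ 3 -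
  (r + s) ^+ 2 * (n (r + s) * (1 + n r) * (1 + n s)) * s ^+ 3).
  rewrite /W0; move: (c / _) (n _) (n _) (n _) (n _) (n _) => *.
  by ring.
have k0 : 0 <= 4 * b ^+ 5 by rewrite mulr_ge0// exprn_ge0// ltW.
rewrite normrM (ger0_norm k0) -[leRHS]mulrA ler_wpM2l//.
rewrite (le_trans (ler_normB _ _))// (ger0_norm t3) (ger0_norm (addr_ge0 t1 t2)).
apply: (le_trans (lerD (lerD u1 u2) u3)).
rewrite -/C1 -(addrA (C1 * _)) -mulrDr [leRHS](mulrDl C1) lerD2l -[leRHS]mulrA.
rewrite ler_wpM2l ?mulr_ge0 ?addr_ge0 ?(ltW bV0)//.
move: H2 H3 H4 (ltW bV0).
move: (expR (- (b * s))) (expR (- (b / 2 * s))) => E F H2 H3 H4; move: (b^-1) => v v0.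
have -> : (s ^+ 2 + s * v) * s ^+ 2 * E + (r + s) * (s ^+ 2 + s * v) * s * E
  = 2 * (s ^+ 4 * E) + (2 * v + r) * (s ^+ 3 * E) + r * v * (s ^+ 2 * E) by ring.
have -> : (2 * D4 + (2 * v + r) * D3 + r * v * D2) * F =
  2 * (D4 * F) + (2 * v + r) * (D3 * F) + r * v * (D2 * F) by ring.
by rewrite !lerD// ler_wpM2l//; nonneg.
Qed.

End collision_kernel.

(** * Radius and direction *)

Section polar_decomposition.
Context {R : realType}.

Lemma enorm_ge0 (p : R3 R) : 0 <= enorm p.
Proof. exact: sqrtr_ge0. Qed.

Lemma enormE (p : R3 R) :
  enorm p = Num.sqrt (p.1.1 ^+ 2 + p.1.2 ^+ 2 + p.2 ^+ 2).
Proof. by rewrite /enorm !big_ord_recl big_ord0 addr0 /coord /= addrA. Qed.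

Lemma enorm_scale3 a (p : R3 R) : enorm (scale3 a p) = `|a| * enorm p.
Proof.
rewrite !enormE /= !exprMn -!mulrDr sqrtrM ?sqr_ge0//.
by rewrite sqrtr_sqr.
Qed.

Lemma enorm_direction (p : R3 R) : enorm p != 0 -> enorm (direction p) = 1.
Proof.
move=> p0; rewrite enorm_scale3 ger0_norm ?invr_ge0 ?enorm_ge0//.
by rewrite mulVf.
Qed.

Lemma direction_scale3 a (p : R3 R) : 0 < a ->
  direction (scale3 a p) = direction p.
Proof.
move=> a0; rewrite /direction enorm_scale3 gtr0_norm// /scale3 /=.
have [->|p0] := eqVneq (enorm p) 0.
  by rewrite mulr0 invr0 !mul0r.
by congr (_, _, _); field; rewrite p0 gt_eqF.
Qed.

Lemma direction_idem (p : R3 R) : enorm p != 0 ->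
  direction (direction p) = direction p.
Proof.
move=> p0; apply: direction_scale3.
by rewrite invr_gt0 lt_neqAle eq_sym p0 enorm_ge0.
Qed.

Lemma enorm_eq0_scale3 a (p : R3 R) : enorm p = 0 -> scale3 a p = 0.
Proof.
rewrite enormE => /eqP; rewrite sqrtr_eq0 => p0.
have : p.1.1 ^+ 2 + p.1.2 ^+ 2 + p.2 ^+ 2 == 0.
  by rewrite eq_le p0/= !addr_ge0 ?sqr_ge0.
rewrite !paddr_eq0 ?addr_ge0 ?sqr_ge0// !sqrf_eq0.
move=> /andP[/andP[/eqP x0 /eqP y0] /eqP z0].
by rewrite /scale3 x0 y0 z0 mulr0.
Qed.

End polar_decomposition.

(** * Balance of the collision operator on radially linear functions *)

Section collision_integral.
Context {R : realType}.
Variables c kB T : R.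
Hypotheses (hc : 0 < c) (hkB : 0 < kB) (hT : 0 < T).

Local Notation mu := (@lebesgue_measure R).

Lemma measurable_n0 : measurable_fun [set: R] (n0 c kB T).
Proof.
apply: (measurableT_comp (@measurable_invr R)); apply: measurable_funB => //.
apply: (measurableT_comp (@measurable_expR R)).
by apply: measurable_funM => //; apply: measurable_funM.
Qed.

Lemma measurable_heaviside : measurable_fun [set: R] (@heaviside R).
Proof.
rewrite (_ : heaviside = \1_(`]0, +oo[%classic : set R)).
  exact: measurable_indic.
apply/funext => x; by rewrite /heaviside indicE mem_setE in_itv/= andbT.
Qed.

Lemma measurable_W0 (r : R) : measurable_fun [set: R] (W0 c kB T r).
Proof.
have mn (f : R -> R) : measurable_fun setT f ->
    measurable_fun setT (fun s => n0 c kB T (f s)).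
  by move=> mf; exact: (measurableT_comp measurable_n0).
have mh (f : R -> R) : measurable_fun setT f ->
    measurable_fun setT (fun s => heaviside (f s)).
  by move=> mf; exact: (measurableT_comp measurable_heaviside).
rewrite /W0; apply: measurable_funM => //.
repeat first [ exact: measurable_cst | exact: measurable_id | apply: mn
  | apply: mh | apply: measurable_funB | apply: measurable_funD
  | apply: measurable_funX | apply: measurable_funM ].
Qed.

(** This convergence is what makes the two sides of the balance finite, so that
    their difference is meaningful. *)
Lemma integrable_W0_moment (r : R) : 0 < r ->
  mu.-integrable `]0, +oo[ (fun s => (W0 c kB T r s * s * s ^+ 2)%:E).
Proof.
move=> r0; have b0 := rate_gt0 hc hkB hT.
have [C HC] := W0_moment_le hc hkB hT r0.
set b := c / (2 * kB * T) in b0 HC.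
have b20 : 0 < b / 2 by rewrite divr_gt0.
have mI : measurable (`]0, +oo[%classic : set R) by exact: measurable_itv.
have mW : measurable_fun [set: R] (fun s => W0 c kB T r s * s * s ^+ 2).
  by repeat first [ exact: measurable_W0 | exact: measurable_id
    | apply: measurable_funX | apply: measurable_funM ].
pose g s := (C / (b / 2) * exponential_pdf (b / 2) s)%:E.
have := @le_integrable _ _ _ mu _ mI
  (fun s => (W0 c kB T r s * s * s ^+ 2)%:E) g; apply.
- by apply/measurable_EFinP; exact: measurable_funTS.
- move=> s; rewrite /= in_itv/= andbT => s0.
  rewrite lee_fin (le_trans (HC s s0))//.
  rewrite exponential_pdfE ?(ltW s0)// mulrA divfK ?gt_eqF// mulNr.
  exact: ler_norm.
- rewrite (_ : g = fun s =>
      ((C / (b / 2))%:E * (exponential_pdf (b / 2) s)%:E)%E); last first.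
    by apply/funext => s; rewrite /g EFinM.
  apply: integrableZl => //; apply: (@integrableS _ _ _ _ setT) => //.
  exact: integrable_exponential_pdf.
Qed.

(** The cancellation holds at every point.  At the origin [direction] takes the
    value 0, so that [Theta] vanishes on the degenerate half-line and both terms
    are 0. *)
Lemma collision_balance (F : R3 R -> R) (p : R3 R) :
  let Theta := fun p : R3 R => F (direction p) * enorm p in
  (- (M c kB T (enorm p) * (Theta p)%:E) + Wint c kB T Theta p = 0)%E.
Proof.
move=> Theta; have [p0|pN0] := eqVneq (enorm p) 0.
  have d0 : direction p = 0 by exact: enorm_eq0_scale3.
  rewrite /Theta p0 mulr0 mule0 oppe0 add0e.
  apply: integral0_eq => s _.
  rewrite enorm_scale3 (_ : enorm (direction p) = 0) ?mulr0 ?mul0r//.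
  by rewrite d0 enormE/= expr0n/= !addr0 sqrtr0.
have p0 : 0 < enorm p by rewrite lt_neqAle eq_sym pN0 enorm_ge0.
have iW := integrable_W0_moment p0.
have mI : measurable (`]0, +oo[%classic : set (measurableTypeR R)).
  exact: measurable_itv.
have -> : Wint c kB T Theta p =
    ((F (direction p))%:E *
      \int[mu]_(s in `]0%R, +oo[) (W0 c kB T (enorm p) s * s * s ^+ 2)%:E)%E.
  rewrite -(integralZl mI iW).
  apply: eq_integral => s; rewrite inE/= in_itv/= andbT => s0.
  rewrite /Theta direction_scale3// direction_idem// enorm_scale3.
  by rewrite enorm_direction// mulr1 gtr0_norm// -EFinM; congr EFin; ring.
have fin := integrable_fin_num mI iW.
rewrite /M -(fineK fin).
rewrite -!EFinM -EFinN -EFinD /Theta; congr EFin.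
by field.
Qed.

End collision_integral.

(** * Completeness of the space of square integrable functions *)

Section square_integrable.
Context d (T : measurableType d) (R : realType).
Variable mu : {measure set T -> \bar R}.
Local Open Scope ereal_scope.

Lemma Lnorm2E (f : T -> R) :
  'N[mu]_2%:E[EFin \o f] = (\int[mu]_x (f x ^+ 2)%:E) `^ 2^-1.
Proof.
rewrite unlock; congr (_ `^ _); apply: eq_integral => x _ /=.
by rewrite powR_mulrn// real_normK// num_real.
Qed.

Lemma Lfun2P (f : T -> R) : f \in Lfun mu 2%:E <->
  measurable_fun setT f /\ \int[mu]_x (f x ^+ 2)%:E < +oo.
Proof.
rewrite inE; split.
  move=> /andP[]; rewrite !inE/= /finite_norm Lnorm2E => mf lf; split => //.
  by apply: lty_poweRy lf.
move=> [mf lf]; apply/andP; split; rewrite inE//= /finite_norm Lnorm2E.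
exact: poweR_lty.
Qed.

Lemma measurable_EFin_sqr (f : T -> R) : measurable_fun setT f ->
  measurable_fun setT (fun x => (f x ^+ 2)%:E).
Proof. by move=> mf; apply/measurable_EFinP; exact: measurable_funX. Qed.

Lemma Lfun2D (f g : T -> R) : f \in Lfun mu 2%:E -> g \in Lfun mu 2%:E ->
  (fun x => f x + g x)%R \in Lfun mu 2%:E.
Proof.
have p1 : 1 <= 2%:E :> \bar R by rewrite lee_fin ler1n.
by move=> fL gL; have [_ /(_ f g fL gL)] := Lfun_addr_closed mu p1.
Qed.

Lemma Lfun2Z (a : R) (f : T -> R) : f \in Lfun mu 2%:E ->
  (fun x => a * f x)%R \in Lfun mu 2%:E.
Proof.
move=> fL; rewrite (_ : (fun x => _) = a \o* f)%R.
  by apply: Lfun_scale => //; rewrite ler1n.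
by apply/funext => x /=; rewrite mulrC.
Qed.

Lemma Lfun2B (f g : T -> R) : f \in Lfun mu 2%:E -> g \in Lfun mu 2%:E ->
  (fun x => f x - g x)%R \in Lfun mu 2%:E.
Proof.
move=> fL gL; rewrite (_ : (fun x => _) = fun x => f x + -1 * g x)%R.
  by apply: Lfun2D => //; exact: Lfun2Z.
by apply/funext => x; rewrite mulN1r.
Qed.

(** The weights 2^k turn square summability into absolute summability of the
    increments: |x| <= 2^k x^2 + 2^-k by the arithmetic-geometric inequality. *)
Lemma cvgn_weighted_increments (v : nat -> R) :
  \sum_(k <oo) (2 ^+ k * (v k.+1 - v k) ^+ 2)%:E < +oo -> cvgn v.
Proof.
move=> vlty.
have w0 k : (0 <= 2 ^+ k * (v k.+1 - v k) ^+ 2)%R.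
  by rewrite mulr_ge0 ?sqr_ge0// exprn_ge0.
have cw := nnseries_is_cvg w0 vlty.
have cg : cvgn (series (geometric (1 : R) 2^-1)).
  by apply: is_cvg_geometric_series; rewrite ger0_norm// invf_lt1// ltr1n.
have cwg : cvgn (series
    (fun k => 2 ^+ k * (v k.+1 - v k) ^+ 2 + 2^-1 ^+ k)%R).
  rewrite (_ : (fun k => _) =
      ((fun k => 2 ^+ k * (v k.+1 - v k) ^+ 2) + geometric (1 : R) 2^-1)%R).
    exact: is_cvg_seriesD cw cg.
  by apply/funext => k; rewrite /geometric /= !fctE mul1r.
have cv : cvgn (series (telescope v)).
  apply: normed_cvg; apply: (series_le_cvg _ _ _ cwg).
  - by move=> n /=.
  - by move=> n /=; rewrite addr_ge0// exprn_ge0// invr_ge0.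
  - move=> n; rewrite /= /telescope /= exprVn.
    rewrite -(real_normK (num_real (v n.+1 - v n))).
    move: (`|_|%R) (normr_ge0 (v n.+1 - v n)%R) => x x0.
    have : (0 < 2 ^+ n :> R)%R by rewrite exprn_gt0.
    move: (2 ^+ n)%R => w wp.
    rewrite -subr_ge0 (_ : _ - x = w * (x - w^-1 / 2) ^+ 2 + w^-1 * (3 / 4))%R.
      by rewrite addr_ge0// mulr_ge0 ?sqr_ge0 ?invr_ge0 ?divr_ge0 ?(ltW wp)//.
    by field; rewrite gt_eqF.
rewrite (_ : v = cst (v 0%N) + series (telescope v))%R; last first.
  by apply/funext => n; rewrite [LHS]eq_sum_telescope.
by apply: is_cvgD => //; exact: is_cvg_cst.
Qed.

(** Riesz-Fischer.  Along a subsequence whose consecutive squared distances are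
    at most 4^-k, the series of 2^k times the squared increments has a finite
    integral, hence is finite almost everywhere, and the subsequence converges
    there.  Fatou's lemma transfers the Cauchy estimate to the limit. *)
Lemma L2_complete (u : nat -> T -> R) :
  (forall n, u n \in Lfun mu 2%:E) ->
  (forall e : R, (0 < e)%R -> exists N, forall m n, (N <= m)%N -> (N <= n)%N ->
     \int[mu]_x ((u m x - u n x) ^+ 2)%:E <= e%:E) ->
  exists2 F, F \in Lfun mu 2%:E &
  (forall e : R, (0 < e)%R -> exists N, forall n, (N <= n)%N ->
     \int[mu]_x ((u n x - F x) ^+ 2)%:E <= e%:E).
Proof.
move=> uL uC.
have mu_ n : measurable_fun setT (u n) by have /Lfun2P[] := uL n.
have /choice[N HN] : forall k : nat, exists N, forall m n, (N <= m)%N -> (N <= n)%N ->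
    \int[mu]_x ((u m x - u n x) ^+ 2)%:E <= (4^-1 ^+ k)%:E.
  by move=> k; apply: uC; rewrite exprn_gt0// invr_gt0.
(* Summing the thresholds makes g dominate all N j with j <= k. *)
pose g k := (\sum_(j < k.+1) N j)%N.
have gN j k : (j <= k)%N -> (N j <= g k)%N.
  move=> jk; rewrite /g (bigD1 (Ordinal (jk : (j < k.+1)%N)))//=; exact: leq_addr.
have msq m n : measurable_fun setT (fun x => ((u m x - u n x) ^+ 2)%:E).
  by apply: measurable_EFin_sqr; exact: measurable_funB.
pose w k x := (2 ^+ k * (u (g k.+1) x - u (g k) x) ^+ 2)%:E.
have w0 k x : 0 <= w k x.
  by rewrite lee_fin mulr_ge0 ?sqr_ge0// exprn_ge0.
have mw k : measurable_fun setT (w k).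
  apply/measurable_EFinP; apply: measurable_funM => //.
  by apply: measurable_funX; exact: measurable_funB.
have wlty : \int[mu]_x (\sum_(k <oo) w k x) < +oo.
  rewrite integral_nneseries//.
  have cg : cvgn (series (geometric (1 : R) 2^-1)).
    by apply: is_cvg_geometric_series; rewrite ger0_norm// invf_lt1// ltr1n.
  apply: (@le_lt_trans _ _ (\sum_(k <oo) (geometric (1 : R) 2^-1 k)%:E)).
    apply: lee_nneseries => [k _ _|k _]; first exact: integral_ge0.
    rewrite /w; under eq_integral do rewrite EFinM.
    have c0 : (0 <= 2 ^+ k :> R)%R by rewrite exprn_ge0.
    have sq0 x : setT x -> 0 <= ((u (g k.+1) x - u (g k) x) ^+ 2)%:E.
      by rewrite lee_fin sqr_ge0.
    rewrite (ge0_integralZl_EFin mu measurableT sq0 (msq _ _) c0).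
    have := HN k (g k.+1) (g k) (gN _ _ (leqnSn k)) (gN _ _ (leqnn k)).
    move=> /(lee_wpmul2l (x := (2 ^+ k)%:E)) H.
    apply: (le_trans (H _)); first by rewrite lee_fin exprn_ge0.
    rewrite -EFinM lee_fin /= mul1r -exprMn.
    by rewrite (_ : 2 * 4^-1 = 2^-1)%R//; field.
  rewrite (_ : (fun n => _) = EFin \o series (geometric (1 : R) 2^-1)).
    by rewrite EFin_lim// ltry.
  by apply/funext => n; rewrite /= /series/= -sumEFin.
have mws : measurable_fun setT (fun x => \sum_(k <oo) w k x).
  exact: ge0_emeasurable_sum.
have ws0 x : 0 <= \sum_(k <oo) w k x by exact: nneseries_ge0.
have iw : mu.-integrable setT (fun x => \sum_(k <oo) w k x).
  apply/integrableP; split => //.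
  by under eq_integral do rewrite gee0_abs//.
have aecv : {ae mu, forall x, cvgn (fun k => u (g k) x)}.
  have := integrable_ae measurableT iw; apply: filterS => x /(_ Logic.I) fx.
  apply: cvgn_weighted_increments.
  by move: fx; rewrite ge0_fin_numE.
(* The upper limit is measurable, and it is the limit where that exists. *)
pose F x := fine (limn_esup (fun k => (u (g k) x)%:E)).
have mF : measurable_fun setT F.
  apply: (measurableT_comp (@fine_measurable R setT measurableT)).
  apply: measurable_fun_limn_esup => // k.
  exact/measurable_EFinP.
have cvF x : cvgn (fun k => u (g k) x) -> (fun k => u (g k) x) @ \oo --> F x.
  move=> /cvg_ex[l ul]; suff -> : F x = l by [].
  rewrite /F.
  have El : (fun k => (u (g k) x)%:E) @ \oo --> l%:E.
    by apply: cvg_EFin => //; exact: nearW.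
  by have [_ ->] := cvg_limn_einf_sup El.
have bound j n : (N j <= n)%N ->
    \int[mu]_x ((u n x - F x) ^+ 2)%:E <= (4^-1 ^+ j)%:E.
  move=> jn.
  (* Shifting by j makes the Cauchy estimate valid for every index k. *)
  have f0 k x : setT x -> 0 <= ((u n x - u (g (k + j)%N) x) ^+ 2)%:E.
    by rewrite lee_fin sqr_ge0.
  have fat := fatou mu measurableT (fun k => msq n (g (k + j)%N)) f0.
  apply: (@le_trans _ _ (\int[mu]_x
      limn_einf (fun k => ((u n x - u (g (k + j)%N) x) ^+ 2)%:E))).
    apply: ae_ge0_le_integral => //.
    - by move=> x _; rewrite lee_fin sqr_ge0.
    - by apply: measurable_EFin_sqr; exact: measurable_funB.
    - move=> x _.
      rewrite limn_einf_lim; apply: lime_ge; first exact: is_cvg_einfs.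
      apply: nearW => k; apply: le_ereal_inf_tmp => _ [i _ <-].
      by rewrite lee_fin sqr_ge0.
    - have mN := @measurable_fun_limn_esup _ T R setT
        (fun k x => - ((u n x - u (g (k + j)%N) x) ^+ 2)%:E).
      rewrite /limn_einf; apply: measurableT_comp => //; apply: mN => // k.
      exact: measurableT_comp.
    - move: aecv; apply: filterS => x /cvF ux _.
      have : (fun k => ((u n x - u (g (k + j)%N) x) ^+ 2)%:E) @ \oo -->
          ((u n x - F x) ^+ 2)%:E.
        apply: cvg_EFin; first by exact: nearW.
        rewrite /=.
        have ujx : (fun k => u (g (k + j)%N) x) @ \oo --> F x.
          by rewrite (cvg_shiftn j (fun k => u (g k) x)).
        by under eq_fun do rewrite expr2; rewrite expr2; apply: cvgM;
          (apply: cvgB => //; exact: cvg_cst).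
      by move=> /cvg_limn_einf_sup[-> _].
  apply: (le_trans fat); rewrite limn_einf_lim.
  apply: lime_le; first exact: is_cvg_einfs.
  apply: nearW => k; apply: (@le_trans _ _
    (\int[mu]_x ((u n x - u (g (k + j)%N) x) ^+ 2)%:E)).
    by apply: ereal_inf_lbound; exists k => /=.
  by apply: HN => //; apply: gN; exact: leq_addl.
have small (e : R) : (0 < e)%R -> exists j, (4^-1 ^+ j <= e)%R.
  move=> e0; have : geometric (1 : R) 4^-1 @ \oo --> 0%R.
    by apply: cvg_geometric; rewrite ger0_norm// invf_lt1// ltr1n.
  move=> /cvgrPdist_le /(_ e e0) [j _ /(_ j (leqnn j))].
  rewrite /geometric/= mul1r sub0r normrN ger0_norm ?exprn_ge0 ?invr_ge0// => je.
  by exists j.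
exists F.
  have uNF : (fun x => u (N 0%N) x - F x)%R \in Lfun mu 2%:E.
    apply/Lfun2P; split; first exact: measurable_funB.
    by rewrite (le_lt_trans (bound 0%N _ (leqnn _)))// ltry.
  rewrite (_ : F = fun x => u (N 0%N) x - (u (N 0%N) x - F x))%R; first exact: Lfun2B.
  by apply/funext => x; rewrite subKr.
move=> e /small[j je]; exists (N j) => n jn.
by rewrite (le_trans (bound _ _ jn))// lee_fin.
Qed.

End square_integrable.

(** * Orthonormal series on the sphere *)

Section orthonormal_sums.
Context d (T : measurableType d) (R : realType).
Variable mu : {measure set T -> \bar R}.
Variables (I : eqType) (e : I -> T -> R) (c : I -> R).

Local Notation S s := (fun x => \sum_(i <- s) c i * e i x).

Lemma Lfun2_sum (s : seq I) :
  {in s, forall i, e i \in Lfun mu 2%:E} -> S s \in Lfun mu 2%:E.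
Proof.
elim: s => [_|i s IH es].
  rewrite (_ : (fun x => _) = cst 0); last first.
    by apply/funext => x; rewrite big_nil.
  by have [] := Lfun_addr_closed mu (p := 2%:E) (lee1n 2).
rewrite (_ : (fun x => _) = fun x => c i * e i x + S s x); last first.
  by apply/funext => x; rewrite big_cons.
apply: Lfun2D; first by apply: Lfun2Z; apply: es; rewrite mem_head.
by apply: IH => j js; apply: es; rewrite in_cons js orbT.
Qed.

Lemma Lfun2_integrableM (f g : T -> R) :
  f \in Lfun mu 2%:E -> g \in Lfun mu 2%:E ->
  mu.-integrable setT (EFin \o (fun x => f x * g x)).
Proof. by move=> fL gL; apply/Lfun1_integrable; exact: Lfun2_mul_Lfun1. Qed.

Lemma Rintegral_suml (s : seq I) (g : T -> R) :
  {in s, forall i, e i \in Lfun mu 2%:E} -> g \in Lfun mu 2%:E ->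
  \int[mu]_x (S s x * g x) = \sum_(i <- s) c i * \int[mu]_x (e i x * g x).
Proof.
move=> es gL; elim: s es => [_|i s IH es].
  rewrite big_nil; under eq_Rintegral do rewrite big_nil mul0r.
  by rewrite Rintegral_cst// mul0r.
have ei : e i \in Lfun mu 2%:E by apply: es; rewrite mem_head.
have es' : {in s, forall j, e j \in Lfun mu 2%:E}.
  by move=> j js; apply: es; rewrite in_cons js orbT.
rewrite big_cons -IH// -RintegralZl//; last exact: Lfun2_integrableM.
under eq_Rintegral do rewrite big_cons mulrDl -mulrA.
rewrite RintegralD//; last exact: (Lfun2_integrableM (Lfun2_sum es')).
rewrite (_ : _ \o _ = EFin \o (fun x => (c i * e i x) * g x)).
  exact: (Lfun2_integrableM (Lfun2Z _ ei)).
by apply/funext => x /=; rewrite mulrA.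
Qed.

(** The double sum of inner products reduces to its diagonal. *)
Lemma integral_sqr_orthonormal (s : seq I) : uniq s ->
  {in s, forall i, e i \in Lfun mu 2%:E} ->
  {in s &, forall i j, \int[mu]_x (e i x * e j x) = (i == j)%:R} ->
  (\int[mu]_x ((S s x) ^+ 2)%:E = (\sum_(i <- s) c i ^+ 2)%:E)%E.
Proof.
move=> us es on; have SL := Lfun2_sum es.
have iS := Lfun2_integrableM SL SL.
transitivity ((\int[mu]_x (S s x * S s x))%:E).
  rewrite /Rintegral fineK; last exact: integrable_fin_num.
  by apply: eq_integral => x _; rewrite expr2.
congr EFin; rewrite Rintegral_suml//.
rewrite big_seq [RHS]big_seq; apply: eq_bigr => i si.
under eq_Rintegral do rewrite mulrC.
rewrite Rintegral_suml//; last exact: es.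
rewrite (bigD1_seq i)//= on// eqxx mulr1 big_seq_cond big1 ?addr0 ?expr2//.
by move=> j /andP[js ji]; rewrite on// (negbTE ji) mulr0.
Qed.

End orthonormal_sums.

Section fourier_series.
Context {R : realType}.
Variable Y : nat -> int -> R3 R -> R.
Hypothesis hY : real_spherical_harmonic_basis Y.
Variable a : nat -> int -> R.
Hypothesis ha : square_summable a.

Let idx (l : nat) (j : nat) : nat * int := (l, j%:Z - l%:Z).
(* A flat list of indices, so that the double sum becomes an orthonormal sum. *)
Let block (K L : nat) : seq (nat * int) :=
  [seq idx l j | l <- index_iota K L, j <- iota 0 (2 * l).+1].
Let energy (l : nat) : R := \sum_(j < (2 * l).+1) a l (j%:Z - l%:Z) ^+ 2.

Let sum_block (G : nat * int -> R) K L : \sum_(i <- block K L) G i =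
  \sum_(K <= l < L) \sum_(j < (2 * l).+1) G (l, j%:Z - l%:Z).
Proof.
rewrite big_allpairs_dep; apply: eq_bigr => l _.
by rewrite -[iota _ _]/(index_iota 0 (2 * l).+1) big_mkord.
Qed.

Let uniq_block K L : uniq (block K L).
Proof.
apply: allpairs_uniq_dep => [|l _|]; [exact: iota_uniq|exact: iota_uniq|].
by move=> [l j] [l' j'] _ _ /= [-> /addIr [->]].
Qed.

Let block_range K L i : i \in block K L -> `|i.2| <= i.1%:Z.
Proof.
move=> /allpairsPdep[l [j [_ + ->]]]; rewrite mem_iota add0n => /andP[_ jl] /=.
rewrite ler_norml; apply/andP; split; lia.
Qed.

Lemma partial_sumB K L : (K <= L)%N ->
  (\int[surface]_p ((partial_sum Y a L p - partial_sum Y a K p) ^+ 2)%:E =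
   (\sum_(K <= l < L) energy l)%:E)%E.
Proof.
move=> KL; have [hin hon _] := hY.
have Yin : {in block K L, forall i, Y i.1 i.2 \in Lfun surface 2%:E}.
  by move=> i /block_range /hin[].
have Yon : {in block K L &, forall i j,
    \int[surface]_p (Y i.1 i.2 p * Y j.1 j.2 p) = (i == j)%:R}.
  by move=> i j /block_range ri /block_range rj; rewrite -/(dotS2 _ _) hon// -pair_eqE.
have := integral_sqr_orthonormal (fun i => a i.1 i.2) (uniq_block K L) Yin Yon.
rewrite sum_block => <-; apply: eq_integral => p _; congr (_ ^+ 2)%:E.
rewrite (sum_block (fun i => a i.1 i.2 * Y i.1 i.2 p)) /partial_sum.
rewrite -!(big_mkord xpredT (fun l => \sum_(j < (2 * l).+1)
  a l (j%:Z - l%:Z) * Y l (j%:Z - l%:Z) p)).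
by rewrite (big_cat_nat (leq0n K) KL)/= addrAC subrr add0r.
Qed.

Lemma partial_sum_Lfun L : partial_sum Y a L \in Lfun surface 2%:E.
Proof.
have [hin _ _] := hY.
rewrite (_ : partial_sum Y a L =
    fun p => \sum_(i <- block 0 L) a i.1 i.2 * Y i.1 i.2 p).
  by apply: (Lfun2_sum (fun i => a i.1 i.2)) => i /block_range /hin[].
by apply/funext => p; rewrite sum_block big_mkord.
Qed.

(** The partial sums are Cauchy because the squared coefficients are summable. *)
Lemma L2_sum_exists : exists F, L2_sum Y a F.
Proof.
have e0 l : 0 <= energy l by apply: sumr_ge0 => j _; exact: sqr_ge0.
have cvE : cvgn (series energy) by exact: nnseries_is_cvg.
have [F FL cvF] : exists2 F, F \in Lfun surface 2%:E &
  (forall e : R, 0 < e -> exists N, forall n, (N <= n)%N ->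
     (\int[surface]_p ((partial_sum Y a n p - F p) ^+ 2)%:E <= e%:E)%E).
  apply: (L2_complete partial_sum_Lfun) => e ep.
  have /cauchy_cvgP/cauchy_seriesP/(_ e ep) := cvE.
  case => -[A B] /= [[N1 _ HA] [N2 _ HB]] AB.
  have tail K L : (maxn N1 N2 <= K)%N -> (K <= L)%N -> \sum_(K <= l < L) energy l <= e.
    rewrite geq_max => /andP[K1 K2] KL.
    have /= := AB (K, L) (conj (HA K K1) (HB L (leq_trans K2 KL))).
    by move=> /ltW; apply: le_trans; exact: ler_norm.
  exists (maxn N1 N2) => m n Nm Nn.
  have [nm|/ltnW mn] := leqP n m; first by rewrite partial_sumB// lee_fin tail.
  under eq_integral do rewrite -sqrrN opprB.
  by rewrite partial_sumB// lee_fin tail.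
exists F; split => //.
have EL n : 'N[surface]_2%:E[(fun p => (partial_sum Y a n p - F p)%:E)]%E =
   ((\int[surface]_p ((partial_sum Y a n p - F p) ^+ 2)%:E) `^ 2^-1)%E.
  exact: (Lnorm2E _ (fun p => partial_sum Y a n p - F p)).
have bnd (e : R) : 0 < e -> \forall n \near \oo,
    (0 <= 'N[surface]_2%:E[(fun p => (partial_sum Y a n p - F p)%:E)] <= e%:E)%E.
  move=> ep; have [N HN] := cvF (e ^+ 2) (exprn_gt0 2 ep).
  exists N => // n /= /HN le_e; rewrite Lnorm_ge0/= EL.
  have -> : e%:E = ((e ^+ 2)%:E `^ 2^-1)%E.
    by rewrite poweR_EFin powR12_sqrt ?sqr_ge0// sqrtr_sqr gtr0_norm.
  have I0 : (0 <= \int[surface]_p ((partial_sum Y a n p - F p) ^+ 2)%:E)%E.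
    by apply: integral_ge0 => p _; rewrite lee_fin sqr_ge0.
  apply: gt0_ler_poweR => //; rewrite in_itv/= leey andbT//.
  by rewrite lee_fin sqr_ge0.
apply/fine_cvgP; split.
  apply: filterS (bnd 1 ltr01) => n /andP[n0 n1].
  by rewrite ge0_fin_numE// (le_lt_trans n1)// ltry.
apply/cvgrPdist_le => e ep; apply: filterS (bnd e ep) => n /andP[n0 ne].
have nf : 'N[surface]_2%:E[(fun p => (partial_sum Y a n p - F p)%:E)]%E \is a fin_num.
  by rewrite ge0_fin_numE// (le_lt_trans ne)// ltry.
by rewrite /= sub0r normrN ger0_norm ?fine_ge0// -lee_fin fineK.
Qed.

End fourier_series.

(** * Change of measure and dilations of Lebesgue measure *)

Section change_of_measure.
Local Open Scope ereal_scope.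
Import HBNNSimple.

(** True of simple functions by hypothesis, hence of all nonnegative functions by
    monotone convergence on both sides. *)
Lemma ge0_integral_density d (T : measurableType d) (R : realType)
    (mu nu : {measure set T -> \bar R}) (w : T -> R) :
  measurable_fun setT w -> (forall x, (0 <= w x)%R) ->
  (forall A, measurable A -> nu A = \int[mu]_(x in A) (w x)%:E) ->
  forall f : T -> \bar R, measurable_fun setT f -> (forall x, 0 <= f x) ->
  \int[nu]_x f x = \int[mu]_x (f x * (w x)%:E).
Proof.
move=> mw w0 nuE f mf f0; pose h := nnsfun_approx measurableT mf.
have mEw : measurable_fun setT (EFin \o w) by exact/measurable_EFinP.
have hcv x : (h n x)%:E @[n --> \oo] --> f x.
  by apply: cvg_nnsfun_approx => // y _; exact: f0.
have mh n : measurable_fun setT (fun x => (h n x)%:E).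
  by apply/measurable_EFinP; exact: measurable_funP.
have hnd x m n : (m <= n)%N -> (h m x)%:E <= (h n x)%:E.
  by move=> mn; rewrite lee_fin; exact/lefP/nd_nnsfun_approx.
have mind (r : R) n : measurable_fun setT (fun x => (r * \1_(h n @^-1` [set r]) x)%:E).
  by apply/measurable_EFinP; exact: measurable_funM.
have step n : \int[nu]_x (h n x)%:E = \int[mu]_x ((h n x)%:E * (w x)%:E).
  transitivity (\int[nu]_x (\sum_(r \in range (h n))
      (r * \1_(h n @^-1` [set r]) x)%:E)).
    by apply: eq_integral => x _; rewrite fsumEFin// -fimfunE.
  rewrite ge0_integral_fsum//; last by move=> r x _; exact: nnfun_muleindic_ge0.
  transitivity (\int[mu]_x (\sum_(r \in range (h n))
      (r * \1_(h n @^-1` [set r]) x)%:E * (w x)%:E)).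
    rewrite ge0_integral_fsum//; last 2 first.
    - by move=> r; exact: emeasurable_funM.
    - move=> r x _; apply: mule_ge0; last by rewrite lee_fin.
      exact: nnfun_muleindic_ge0.
    apply: eq_fsbigr => r rh.
    have r0 : (0 <= r)%R by move: rh => /[!inE] -[x _ <-].
    have mr : measurable (h n @^-1` [set r]) by exact: measurable_sfunP.
    under eq_integral do rewrite EFinM.
    under [RHS]eq_integral do rewrite EFinM -muleA.
    pose g x : \bar R := (\1_(h n @^-1` [set r]) x)%:E.
    have mg : measurable_fun setT g by exact/measurable_EFinP.
    have g0 x : setT x -> 0 <= g x by rewrite lee_fin.
    have mgw : measurable_fun setT (fun x => g x * (w x)%:E).
      exact: emeasurable_funM.
    have gw0 x : setT x -> 0 <= g x * (w x)%:E by rewrite mule_ge0 ?lee_fin.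
    rewrite (ge0_integralZl_EFin nu measurableT g0 mg r0).
    rewrite (ge0_integralZl_EFin mu measurableT gw0 mgw r0) /g.
    congr (_ * _); rewrite integral_indic// setIT nuE//.
    rewrite integral_mkcond; apply: eq_integral => x _.
    rewrite patchE indicE; case: ifPn => _; first by rewrite mul1e.
    by rewrite mul0e.
  apply: eq_integral => x _; rewrite -ge0_mule_fsuml => [|r].
    by rewrite fsumEFin// -fimfunE.
  exact: nnfun_muleindic_ge0.
transitivity (limn (fun n => \int[nu]_x (h n x)%:E)).
  rewrite -monotone_convergence//.
  - by apply: eq_integral => x _; apply/esym/cvg_lim => //; exact: hcv.
  - by move=> n x _; rewrite lee_fin.
  - by move=> x _ m n; exact: hnd.
under eq_fun do rewrite step.
rewrite -monotone_convergence//.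
- apply: eq_integral => x _; apply/cvg_lim => //.
  by apply: cvgeZr => //; exact: hcv.
- by move=> n; exact: emeasurable_funM.
- by move=> n x _; rewrite mule_ge0 ?lee_fin.
- by move=> x _ m n mn; rewrite lee_wpmul2r ?lee_fin//; exact: hnd.
Qed.

(** The change of variables formula for a map that transports one measure to a
    multiple of another one; it serves both for dilations and for the passage
    from the ball to the sphere. *)
Lemma ge0_integral_image d1 d2 (T1 : measurableType d1) (T2 : measurableType d2)
    (R : realType) (m1 : {measure set T1 -> \bar R})
    (m2 : {measure set T2 -> \bar R}) (phi : T1 -> T2) (k : {nonneg R}) :
  measurable_fun setT phi ->
  (forall A, measurable A -> m1 (phi @^-1` A) = k%:num%:E * m2 A) ->
  forall D (f : T2 -> \bar R), measurable D -> measurable_fun setT f ->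
    (forall y, 0 <= f y) ->
  \int[m1]_(x in phi @^-1` D) f (phi x) = k%:num%:E * \int[m2]_(y in D) f y.
Proof.
move=> mphi m12 D f mD mf f0.
have mfD : measurable_fun D f by exact: measurable_funTS.
rewrite -ge0_integral_mscale//.
rewrite -(ge0_integral_pushforward mphi)//.
by apply: eq_measure_integral => //= A mA _; exact: m12.
Qed.

(** The section of the preimage is the preimage of a section, so the factors of
    the second and of the first coordinate come out one after the other. *)
Lemma product_measure_image d1 d2 (T1 : measurableType d1)
    (T2 : measurableType d2) (R : realType) (m1 : {measure set T1 -> \bar R})
    (m2 : {sigma_finite_measure set T2 -> \bar R})
    (phi1 : T1 -> T1) (phi2 : T2 -> T2) (k1 k2 : {nonneg R}) :
  measurable_fun setT phi1 ->
  (forall A, measurable A -> m1 (phi1 @^-1` A) = k1%:num%:E * m1 A) ->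
  (forall A, measurable A -> m2 (phi2 @^-1` A) = k2%:num%:E * m2 A) ->
  forall A, measurable A ->
    (m1 \x m2) ((fun x => (phi1 x.1, phi2 x.2)) @^-1` A) =
    (k2%:num * k1%:num)%:E * (m1 \x m2) A.
Proof.
move=> mphi1 h1 h2 A mA.
have mx := @measurable_fun_xsection _ _ T1 T2 R m2 A mA.
rewrite /product_measure1 /=.
transitivity (\int[m1]_x (k2%:num%:E * (m2 \o xsection A) (phi1 x))).
  apply: eq_integral => x _.
  have E : xsection ((fun x => (phi1 x.1, phi2 x.2)) @^-1` A) x =
      phi2 @^-1` xsection A (phi1 x).
    by apply/seteqP; split => y /=; rewrite /xsection/= !inE.
  by rewrite /= E h2//; exact: measurable_xsection.
rewrite ge0_integralZl_EFin//; last exact: measurableT_comp mx mphi1.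
rewrite EFinM -muleA; congr (_ * _).
by rewrite -(ge0_integral_image mphi1 h1 measurableT mx).
Qed.

End change_of_measure.

Section dilations.
Context {R : realType}.

(** Both sides are measures that agree on half-open intervals. *)
Lemma lebesgue_measure_dilation (t : R) (A : set (measurableTypeR R)) : 0 < t ->
  measurable A -> (@lebesgue_measure R ((fun x => t^-1 * x)%R @^-1` A) =
    t%:E * lebesgue_measure A)%E.
Proof.
move=> t0 mA.
pose phi (x : measurableTypeR R) : measurableTypeR R := (t^-1 * x)%R.
have mphi : measurable_fun setT phi by exact: measurable_funM.
have tV0 : 0 <= t^-1 by rewrite invr_ge0 ltW.
pose m' := mscale (NngNum tV0) (pushforward (@lebesgue_measure R) phi).
pose m := m' mphi.
have mE X : ocitv X -> @lebesgue_measure R X = m X.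
  move=> [[a b] _ <-] /=; rewrite /m /m' /mscale /pushforward /=.
  have E : phi @^-1` `]a, b]%classic = `](t * a)%R, (t * b)%R]%classic.
    apply/seteqP; split => x; rewrite /phi /= !in_itv/=.
      by rewrite ltr_pdivlMl// ler_pdivrMl.
    by rewrite ltr_pdivlMl// ler_pdivrMl.
  transitivity (t^-1%:E * @lebesgue_measure R `](t * a)%R, (t * b)%R]%classic)%E;
    last by rewrite -E.
  rewrite !lebesgue_measure_itv/= !lte_fin ltr_pM2l//; case: ifP => _.
    by rewrite -!EFinD -EFinM; congr EFin; field; rewrite gt_eqF.
  by rewrite mule0.
rewrite (lebesgue_measure_unique (mu := m) mE mA) /m /m' /mscale /pushforward /=.
by rewrite muleA -EFinM mulfV ?gt_eqF// mul1e.
Qed.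

Lemma leb3_dilation (t : R) (A : set (R3 R)) : 0 < t -> measurable A ->
  (@leb3 R (scale3 t^-1 @^-1` A) = (t ^+ 3)%:E * leb3 A)%E.
Proof.
move=> t0 mA.
have mphi : measurable_fun [set: measurableTypeR R]
    (fun x : measurableTypeR R => t^-1 * x : measurableTypeR R).
  exact: measurable_funM.
pose k := NngNum (ltW t0).
have h1 (B : set (measurableTypeR R)) : measurable B ->
    (@lebesgue_measure R ((fun x => t^-1 * x)%R @^-1` B) =
     k%:num%:E * lebesgue_measure B)%E by exact: lebesgue_measure_dilation.
have kk0 : 0 <= t * t by rewrite mulr_ge0 ?ltW.
have h2 := product_measure_image (m1 := @lebesgue_measure R)
  (m2 := @lebesgue_measure R) mphi h1 h1.
have mphi2 : measurable_fun [set: (measurableTypeR R * measurableTypeR R)%type]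
    (fun x => (t^-1 * x.1 : measurableTypeR R, t^-1 * x.2 : measurableTypeR R)).
  apply: measurable_fun_pair.
    exact: (measurableT_comp mphi measurable_fst).
  exact: (measurableT_comp mphi measurable_snd).
have := product_measure_image (m2 := @lebesgue_measure R)
  (k1 := NngNum kk0) mphi2 h2 h1 mA.
by move=> /= ->; rewrite !exprS expr0 mulr1.
Qed.

End dilations.

(** * Square integrability for the weight 1/sinh^2 *)

Section sinh_weight.
Context {R : realType}.
Implicit Types x r b : R.

Lemma sinh_ge x : 0 < x -> x / 2 <= sinh x /\ x ^+ 3 / 12 <= sinh x.
Proof.
move=> x0; have e1 : expR (- x) <= 1 by rewrite expR_le1 oppr_le0 ltW.
have e2 := expR_ge1Dx x.
have := @expR_ge1Dxn _ x 2 (ltW x0); rewrite (_ : 3`!%:R = 6 :> R)// => e3.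
by rewrite /sinh; split; lra.
Qed.

(** The bounds of [sinh_ge] by x/2 and x^3/12 serve in the ball n = 0 and in the
    outer shells respectively; on the shell 2^(n-1) < r <= 2^n one has
    r^-4 <= 16 * 16^-n. *)
Lemma sqr_div_sinh_le b : 0 < b -> exists2 K : R, 0 <= K &
  forall r, 0 < r -> exists2 n : nat, r <= 2 ^+ n &
    r ^+ 2 * (sinh (b * r) ^+ 2)^-1 <= K * 16^-1 ^+ n.
Proof.
move=> b0; exists ((2 / b) ^+ 2 + 16 * (12 / b ^+ 3) ^+ 2).
  by nonneg.
move=> r r0; have br0 : 0 < b * r by rewrite mulr_gt0.
have [s1 s3] := sinh_ge br0.
have exn : exists n, r <= 2 ^+ n.
  exists (Num.bound r); apply: (@le_trans _ _ (Num.bound r)%:R).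
    exact/ltW/archi_boundP/ltW.
  by rewrite -natrX ler_nat ltnW// ltn_expl.
have sq (u v : R) : 0 < u -> u <= v -> (v ^+ 2)^-1 <= (u ^+ 2)^-1.
  move=> u0 uv; have v0 : 0 < v by exact: lt_le_trans uv.
  by rewrite lef_pV2 ?posrE ?exprn_gt0// ler_pXn2r ?nnegrE// ltW.
case: (ex_minnP exn) => -[|n] rn nmin.
  exists 0%N => //; rewrite expr0 mulr1.
  apply: (@le_trans _ _ ((2 / b) ^+ 2)); last first.
    by rewrite lerDl; nonneg.
  apply: (@le_trans _ _ (r ^+ 2 * ((b * r / 2) ^+ 2)^-1)).
    by rewrite ler_wpM2l ?sqr_ge0// sq// divr_gt0.
  rewrite le_eqVlt; apply/orP; left; apply/eqP; field.
  by rewrite !gt_eqF.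
exists n.+1 => //.
have nr : 2 ^+ n < r.
  by rewrite ltNge; apply/negP => /nmin; rewrite ltnn.
apply: (@le_trans _ _ (16 * (12 / b ^+ 3) ^+ 2 * 16^-1 ^+ n.+1)); last first.
  by rewrite ler_wpM2r ?exprn_ge0 ?invr_ge0// lerDr sqr_ge0.
apply: (@le_trans _ _ (r ^+ 2 * (((b * r) ^+ 3 / 12) ^+ 2)^-1)).
  by rewrite ler_wpM2l ?sqr_ge0// sq// divr_gt0// exprn_gt0.
have -> : r ^+ 2 * (((b * r) ^+ 3 / 12) ^+ 2)^-1 = (12 / b ^+ 3) ^+ 2 * (r ^+ 4)^-1.
  by field; rewrite !gt_eqF.
rewrite (_ : 16 * _ * _ = (12 / b ^+ 3) ^+ 2 * 16^-1 ^+ n); last first.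
  by rewrite (exprS _ n); move: (12 / b ^+ 3) (16^-1 ^+ n) => X Z; field.
rewrite ler_wpM2l ?sqr_ge0// exprVn lef_pV2 ?posrE ?exprn_gt0//.
rewrite (_ : 16 = 2 ^+ 4 :> R); last by rewrite -natrX.
by rewrite -exprM mulnC exprM ler_pXn2r ?nnegrE ?exprn_ge0 ?(ltW r0)// ltW.
Qed.

End sinh_weight.

Section weighted_L2.
Context {R : realType}.
Variables c kB T : R.
Hypotheses (hc : 0 < c) (hkB : 0 < kB) (hT : 0 < T).
Variable F : R3 R -> R.
Hypothesis FL : F \in Lfun surface 2%:E.

Lemma measurable_punctured_ball : measurable (@punctured_ball R).
Proof.
rewrite (_ : punctured_ball = @enorm R @^-1` `]0, 1]%classic).
  by rewrite -[X in measurable X]setTI; apply: measurable_enorm.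
by apply/seteqP; split => p /=; rewrite in_itv.
Qed.

Lemma measurable_scale3 (t : R) : measurable_fun [set: R3 R] (scale3 t).
Proof.
apply: measurable_fun_pair; [apply: measurable_fun_pair|].
- apply: measurable_funM => //.
  exact: measurableT_comp measurable_fst measurable_fst.
- apply: measurable_funM => //.
  exact: measurableT_comp measurable_snd measurable_fst.
- by apply: measurable_funM => //; exact: measurable_snd.
Qed.

Local Notation G := (fun p : R3 R =>
  ((F (direction p) ^+ 2)%:E * (\1_punctured_ball p)%:E)%E).

Let mF : measurable_fun setT F. Proof. by have /Lfun2P[] := FL. Qed.

Let mFd : measurable_fun setT (fun p : R3 R => (F (direction p) ^+ 2)%:E).
Proof.
apply: measurable_EFin_sqr.
exact: (measurableT_comp mF (@measurable_direction R)).
Qed.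

Let mpb : measurable_fun setT (\1_(@punctured_ball R) : R3 R -> R).
Proof. exact: measurable_indic measurable_punctured_ball. Qed.

Let mG : measurable_fun setT G.
Proof. by apply: emeasurable_funM => //; exact/measurable_EFinP. Qed.

Let G0 p : (0 <= G p)%E.
Proof. by rewrite mule_ge0// lee_fin ?sqr_ge0. Qed.

(** The map [direction] sends Lebesgue measure on the ball to a third of the
    surface measure. *)
Lemma integral_punctured_ball_lty : (\int[leb3]_p G p < +oo)%E.
Proof.
have [_ Flty] := (Lfun2P _ _).1 FL.
pose m1 := mrestr (@leb3 R) measurable_punctured_ball.
have kV0 : 0 <= (3^-1 : R) by rewrite invr_ge0.
have E A : measurable A -> m1 (direction @^-1` A) = ((NngNum kV0)%:num%:E * surface A)%E.
  move=> mA; rewrite /m1 /mrestr /surface /= muleA -EFinM mulVf// mul1e setIC.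
  by [].
have := ge0_integral_image (@measurable_direction R) E measurableT
  (measurable_EFin_sqr mF) (fun p => _ : (0 <= (F p ^+ 2)%:E)%E).
move=> /(_ (fun p => sqr_ge0 (F p))).
rewrite preimage_setT => H.
rewrite (_ : (\int[leb3]_p G p = \int[m1]_p (F (direction p) ^+ 2)%:E)%E).
  by rewrite H lte_mul_pinfty.
rewrite (@ge0_integral_density _ _ _ leb3 m1 (\1_(@punctured_ball R)))//.
- move=> A mA; rewrite integral_indic//.
    by rewrite setIC.
  exact: measurable_punctured_ball.
- by move=> p; rewrite lee_fin sqr_ge0.
Qed.

(** The weight is bounded by a series of multiples of the indicators of the balls
    of radius 2^n, and each ball is rescaled to the unit ball. *)
Lemma Theta_Lfun :
  (fun p => F (direction p) * enorm p) \in Lfun (sinh_measure c kB T) 2%:E.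
Proof.
have [K K0 HK] := sqr_div_sinh_le (rate_gt0 hc hkB hT).
apply/Lfun2P; have mTh : measurable_fun setT (fun p : R3 R => F (direction p) * enorm p).
  apply: measurable_funM; last exact: measurable_enorm.
  exact: (measurableT_comp mF (@measurable_direction R)).
split => //.
have w0 (p : R3 R) : 0 <= (sinh (kappa c kB T p) ^+ 2)^-1.
  by rewrite invr_ge0 sqr_ge0.
have mw : measurable_fun [set: R3 R] (fun p => (sinh (kappa c kB T p) ^+ 2)^-1).
  have mk : measurable_fun [set: R3 R] (kappa c kB T).
    apply: measurable_funM => //; apply: measurable_funM => //.
    exact: measurable_enorm.
  apply: (measurableT_comp measurable_invr); apply: measurable_funX.
  apply: measurable_funM => //; apply: measurable_funB.
    exact: (measurableT_comp (@measurable_expR R) mk).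
  apply: (measurableT_comp (@measurable_expR R)).
  exact: measurableT_comp mk.
rewrite (ge0_integral_density (mu := @leb3 R)
  (w := fun p => (sinh (kappa c kB T p) ^+ 2)^-1))//; last 2 first.
- exact: measurable_EFin_sqr.
- by move=> p; rewrite lee_fin sqr_ge0.
(* Scaling by 2^-n expresses the ball of radius 2^n by the unit ball. *)
pose g n p := ((K * 16^-1 ^+ n)%:E * G (scale3 (2 ^+ n)^-1 p))%E.
have kn0 n : 0 <= K * 16^-1 ^+ n by rewrite mulr_ge0// exprn_ge0// invr_ge0.
have mGs n : measurable_fun setT (fun p => G (scale3 (2 ^+ n)^-1 p)).
  exact: (measurableT_comp mG (measurable_scale3 _)).
have g0 n p : (0 <= g n p)%E by rewrite mule_ge0// lee_fin.
have mg n : measurable_fun setT (g n) by exact: emeasurable_funM.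
apply: (@le_lt_trans _ _ (\int[leb3]_p \sum_(n <oo) g n p)%E).
  apply: ge0_le_integral => //.
  - by move=> p _; rewrite mule_ge0// lee_fin// sqr_ge0.
  - apply: emeasurable_funM; first exact: measurable_EFin_sqr.
    exact/measurable_EFinP.
  - exact: ge0_emeasurable_sum.
  move=> p _; have [p0|pN0] := eqVneq (enorm p) 0.
    by rewrite p0 mulr0 expr0n mul0e; exact: nneseries_ge0.
  have p0 : 0 < enorm p by rewrite lt_neqAle eq_sym pN0 enorm_ge0.
  have [n pn kn] := HK _ p0.
  apply: (@le_trans _ _ (g n p)); last first.
    apply: (@le_trans _ _ (\sum_(0 <= i < n.+1) g i p)%E).
      by rewrite big_nat_recr//= leeDr// sume_ge0.
    exact: nneseries_lim_ge.
  have t0 : 0 < (2 ^+ n)^-1 :> R by rewrite invr_gt0 exprn_gt0.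
  rewrite /g direction_scale3// indicE mem_set ?mule1; last first.
    rewrite /punctured_ball/= enorm_scale3 gtr0_norm// mulr_gt0//=.
    by rewrite ler_pdivrMl ?exprn_gt0// mulr1.
  have -> : kappa c kB T p = c / (2 * kB * T) * enorm p by rewrite /kappa mulrAC.
  rewrite -!EFinM lee_fin exprMn -[leLHS]mulrA [leLHS]mulrC.
  by rewrite ler_wpM2r ?sqr_ge0.
rewrite integral_nneseries//.
have gE n : (\int[leb3]_p g n p = (K * 2^-1 ^+ n)%:E * \int[leb3]_p G p)%E.
  have t0 : 0 < (2 ^+ n) :> R by rewrite exprn_gt0.
  have t30 : 0 <= (2 ^+ n) ^+ 3 :> R by rewrite exprn_ge0 ?ltW.
  have P0 p : setT p -> (0 <= G (scale3 (2 ^+ n)^-1 p))%E by [].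
  rewrite (ge0_integralZl_EFin _ measurableT P0 (mGs n) (kn0 n)).
  have := ge0_integral_image (m1 := leb3) (m2 := leb3) (k := NngNum t30)
    (measurable_scale3 (2 ^+ n)^-1)
    (fun A => leb3_dilation t0) measurableT mG G0.
  rewrite preimage_setT => -> /=; rewrite muleA -EFinM; congr (_%:E * _)%E.
  rewrite -mulrA; congr (K * _); rewrite -exprM mulnC exprM -exprMn.
  by congr (_ ^+ n); field.
rewrite (eq_eseriesr (fun n _ => gE n)).
have IG0 : (0 <= \int[leb3]_p G p)%E by exact: integral_ge0.
have IGlty := integral_punctured_ball_lty.
have [S SE] : exists S, (\int[leb3]_p G p)%E = S%:E.
  by exists (fine (\int[leb3]_p G p)%E); rewrite fineK// ge0_fin_numE.
rewrite SE in IG0 *.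
have cg : cvgn (series (geometric (K * S) 2^-1)).
  by apply: is_cvg_geometric_series; rewrite ger0_norm// invf_lt1// ltr1n.
rewrite (_ : (fun n => _) = EFin \o series (geometric (K * S) 2^-1)).
  by rewrite EFin_lim// ltry.
apply/funext => n; rewrite /= /series/= -sumEFin; apply: eq_bigr => i _.
by rewrite -EFinM mulrAC.
Qed.

End weighted_L2.

Theorem proposition1p1 (R : realType) (c kB T : R)
    (hc : 0 < c) (hkB : 0 < kB) (hT : 0 < T)
    (Y : nat -> int -> R3 R -> R) (hY : real_spherical_harmonic_basis Y)
    (a : nat -> int -> R) (ha : square_summable a) :
  (exists F : R3 R -> R, L2_sum Y a F) /\
  (forall F : R3 R -> R, L2_sum Y a F ->
   let Theta := fun p : R3 R => F (direction p) * enorm p in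
   Theta \in Lfun (sinh_measure c kB T) 2%:E /\
   {ae leb3, forall p : R3 R,
     (- (M c kB T (enorm p) * (Theta p)%:E) + Wint c kB T Theta p = 0)%E}).
Proof.
split; first exact: L2_sum_exists.
move=> F [FL _] Theta; split; first exact: Theta_Lfun.
by apply: aeW => p; exact: collision_balance.
Qed.
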